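(* Let $\Phi : \mathbb{N} \rightarrow \mathbb{R}_{>0}$ be a function. The set of all $\theta \in \mathbb{R}_{>0}$ such that there are infinitely many $n\in\mathbb{N}$ satisfying $0<\|n^{\theta}\| \leq \Phi(n)$ is an uncountable set that is dense in $\mathbb{R}_{>0}$.
   Context: $\mathbb{N}=\{1,2,\ldots\}$. For real $x$, $\|x\| := \min_{m\in\mathbb{Z}}|x-m|$ denotes the distance to the nearest integer. *)

(* Defs.v *)
From mathcomp Require Import all_boot all_order all_algebra.
From mathcomp Require Import all_classical all_reals all_analysis.

Set Implicit Arguments.
Unset Strict Implicit.
Unset Printing Implicit Defensive.

Import Order.TTheory GRing.Theory Num.Theory.
Import numFieldNormedType.Exports.

Local Open Scope classical_set_scope.
Local Open Scope ring_scope.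

(* The infimum is a minimum: see [dist_intP]. *)
Definition dist_int (R : realType) (x : R) : R :=
  inf (range (fun m : int => `|x - m%:~R|)).

Lemma dist_intP (R : realType) (x : R) :
  (exists m : int, dist_int x = `|x - m%:~R|) /\
  (forall m : int, dist_int x <= `|x - m%:~R|).
Proof.
have lbA : has_lbound (range (fun m : int => `|x - m%:~R|)).
  by exists 0 => _ [m _ <-].
have le_inf (m : int) : dist_int x <= `|x - m%:~R|.
  by apply: ge_inf => //; exists m.
split=> //.
pose f := Num.floor x.
have fx : f%:~R <= x by exact: floor_le.
have xf : x < (f + 1)%:~R by exact: floorD1_gt.
have key : Num.min `|x - f%:~R| `|x - (f + 1)%:~R| <= dist_int x.
  apply: lb_le_inf; first by exists `|x - f%:~R|, f.
  move=> _ [m _ <-]; rewrite ge_min.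
  apply/orP; have [mf|fm] := lerP m f; [left|right].
    rewrite (ger0_norm (_ : 0 <= x - f%:~R)) ?subr_ge0//.
    by apply: le_trans (ler_norm _); rewrite lerD2l lerN2 ler_int.
  rewrite (distrC x) (distrC x) (ger0_norm (_ : 0 <= (f + 1)%:~R - x)).
    by apply: le_trans (ler_norm _); rewrite lerD2r ler_int lezD1.
  by rewrite subr_ge0 ltW.
move: key; rewrite ge_min => /orP[] h.
  by exists f; apply/eqP; rewrite eq_le le_inf.
by exists (f + 1); apply/eqP; rewrite eq_le le_inf.
Qed.

Definition approx_exponents (R : realType) (Phi : nat -> R) : set R :=
  [set theta : R | 0 < theta /\
     infinite_set [set n : nat | (0 < n)%N /\
       0 < dist_int (n%:R `^ theta) <= Phi n]].

(* Main.v *)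
Require Import Defs.
From mathcomp Require Import all_boot all_order all_algebra.
From mathcomp Require Import all_classical all_reals all_analysis.
From mathcomp Require Import lra.

Import Order.TTheory GRing.Theory Num.Theory.
Import numFieldNormedType.Exports.

Local Open Scope classical_set_scope.
Local Open Scope ring_scope.

(** The exponents in question form a residual subset of the positive reals, so
    Baire's theorem gives both claims at once: a residual set meets every
    nonempty open set, and still does so after a countable set is deleted,
    since each deleted point costs one more dense open condition.

    Residuality comes from two facts about a positive integer base [n]. The condition
    that [n^theta] lies slightly above an integer, at a distance less than
    [Phi n], is open in [theta] because [theta |-> n^theta] is continuous
    ([open_near_above]). And for large [n] it is met on any prescribed interval
    [a < theta < b] with [0 < a], because the length of the interval
    [n^a, n^b] tends to infinity with [n], so that it contains an integer
    together with a whole half-unit above it ([near_above_itv]). Hence, for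
    every [N], the exponents that are good for some [n >= N] form a dense open
    subset of the positive reals, and an exponent belonging to all these sets
    is good for infinitely many [n]. *)

Lemma unbounded_infinite_set (A : set nat) :
  (forall N, exists2 n, (N <= n)%N & A n) -> infinite_set A.
Proof.
move=> unbA /finite_seqP[s As].
have [n + An] := unbA (\max_(i <- s) i).+1; rewrite ltnNge => /negP; apply.
by apply: leq_bigmax_seq => //; rewrite As in An.
Qed.

Lemma dist_int_right (R : realType) (x : R) (m : int) :
  0 <= x - m%:~R <= 2^-1 -> dist_int x = x - m%:~R.
Proof.
move=> /andP[x0 x2]; have [[k ->] /(_ m)] := dist_intP x.
rewrite (ger0_norm x0) => km.
have [/eqP->|kNm] := boolP (k == m); first by rewrite ger0_norm.
apply/eqP; rewrite eq_le km /=.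
(* A different integer is at distance at least one from [m], hence at least
   one half from [x]. *)
have : (k <= m - 1) || (m + 1 <= k).
  by rewrite lezD1 lerBrDr lezD1 -neq_lt.
case/orP; rewrite -(ler_int R) ?rmorphD ?rmorphN /= => h.
  by apply: le_trans (ler_norm _); lra.
by rewrite distrC; apply: le_trans (ler_norm _); lra.
Qed.

Section NearAbove.
Variables (R : realType) (Phi : nat -> R).
Hypothesis Phi_gt0 : forall n : nat, (0 < n)%N -> 0 < Phi n.

(** The cap at one half makes the nearest integer the one below [n^theta], so
    that the excess over it is the distance [dist_int]. *)
Definition near_above (n : nat) : set R :=
  \bigcup_(m : int) [set theta |
    m%:~R < n%:R `^ theta < m%:~R + Num.min (Phi n) 2^-1].

Lemma near_above_dist_int n theta : near_above n theta ->
  0 < dist_int (n%:R `^ theta) <= Phi n.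
Proof.
move=> [m _ /= /andP[mx]]; rewrite -ltrBlDl lt_min => /andP[xPhi x2].
rewrite (@dist_int_right _ _ m) ?subr_gt0 ?mx ?(ltW xPhi)//.
by rewrite subr_ge0 !ltW.
Qed.

Lemma open_near_above n : (0 < n)%N -> open (near_above n).
Proof.
move=> n0; apply: bigcup_open => m _.
have cpow : continuous (fun theta : R => n%:R `^ theta).
  move=> theta; under eq_fun do rewrite /powR pnatr_eq0 gtn_eqF//.
  apply: (@continuous_comp _ _ _ (fun t : R => t * ln n%:R) expR).
    exact: mulrr_continuous.
  exact: continuous_expR.
rewrite (_ : [set _ | _] = (fun theta : R => n%:R `^ theta) @^-1`
    `]m%:~R, m%:~R + Num.min (Phi n) 2^-1[); last first.
  by apply/seteqP; split=> t /=; rewrite in_itv.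
by apply: open_comp; [move=> *; exact: cpow | exact: itv_open].
Qed.

(** Since [n^b - n^a >= (b - a) * ln n], a base [n > exp (2 / (b - a))] makes
    the image interval longer than two. *)
Lemma powR_gap (a b : R) (n : nat) : 0 < a -> a < b ->
  expR (2 / (b - a)) <= n%:R -> n%:R `^ a + 2 <= n%:R `^ b.
Proof.
move=> a0 ab nlarge.
have ba0 : 0 < b - a by rewrite subr_gt0.
have n0 : 0 < n%:R :> R by apply: lt_le_trans nlarge; exact: expR_gt0.
have L2 : 2 / (b - a) <= ln n%:R by rewrite -ler_expR lnK.
have L0 : 0 < ln (n%:R : R) by apply: lt_le_trans L2; rewrite divr_gt0.
rewrite /powR gt_eqF// (_ : b * _ = a * ln n%:R + (b - a) * ln n%:R); last first.
  by rewrite -mulrDl; congr (_ * _); lra.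
rewrite expRD.
have Ea : 1 <= expR (a * ln n%:R) by rewrite ltW// expR_gt1 mulr_gt0.
have Eba : 1 + 2 <= expR ((b - a) * ln n%:R).
  apply: le_trans (expR_ge1Dx _); rewrite lerD2l mulrC.
  by rewrite -ler_pdivrMr.
by nra.
Qed.

Lemma near_above_itv (a b : R) (N : nat) : 0 < a -> a < b ->
  exists n theta, [/\ (N <= n)%N, a < theta < b & near_above n theta].
Proof.
move=> a0 ab; pose n := maxn (maxn N 2) (Num.truncn (expR (2 / (b - a)))).+1.
have Nn : (N <= n)%N by rewrite /n !leq_max leqnn.
have n2 : (1 < n)%N by rewrite /n !leq_max orbT.
have gap : n%:R `^ a + 2 <= n%:R `^ b :> R.
  apply: powR_gap => //; apply: le_trans (ltW (truncnS_gt _)) _.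
  by rewrite ler_nat leq_max leqnn orbT.
have L0 : 0 < ln (n%:R : R) by rewrite ln_gt0// ltr1n.
have n0 : 0 < n%:R :> R by rewrite ltr0n ltnW.
pose d := Num.min (Phi n) 2^-1.
have d0 : 0 < d by rewrite lt_min invr_gt0 ltr0n andbT Phi_gt0// ltnW.
have d2 : d <= 2^-1 by rewrite ge_min lexx orbT.
pose m := Num.floor (n%:R `^ a : R) + 1.
have am : n%:R `^ a < m%:~R :> R by exact: floorD1_gt.
have ma : m%:~R <= n%:R `^ a + 1 :> R.
  by rewrite /m intrD lerD2r; exact: floor_le.
have na0 : 0 < n%:R `^ a :> R by exact: powR_gt0.
pose x := m%:~R + d / 2.
have x0 : 0 < x by rewrite /x; lra.
have nx : n%:R `^ (ln x / ln n%:R) = x.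
  by rewrite /powR gt_eqF// divfK ?gt_eqF// lnK.
exists n, (ln x / ln n%:R); split=> //; last first.
  by exists m => //=; rewrite nx -/d /x; lra.
rewrite ltr_pdivlMr// ltr_pdivrMr// -!ln_powR !ltr_ln ?posrE ?powR_gt0//.
by rewrite /x; lra.
Qed.

(** The negative half-line is added only so that Baire's theorem can be applied
    on the whole real line. *)
Definition good_beyond (N : nat) : set R :=
  [set theta | theta < 0] `|`
  \bigcup_(n in [set n | (maxn N 1 <= n)%N]) near_above n.

Lemma open_good_beyond N : open (good_beyond N).
Proof.
apply: openU; first exact: open_lt.
by apply: bigcup_open => n /=; rewrite geq_max => /andP[_ n0];
  exact: open_near_above.
Qed.

Lemma dense_good_beyond N : dense (good_beyond N).
Proof.
move=> O [x Ox] oO; have [x0|x0] := ltP x 0; first by exists x; split=> //; left.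
have /nbhs_ballP[e /= e0 xO] : nbhs x O by apply: open_nbhs_nbhs.
have [||n [t [Nn /andP[xt te] Vt]]] :=
  @near_above_itv (x + e / 2) (x + e) (maxn N 1); [lra | lra |].
exists t; split; last by right; exists n.
by apply: xO; rewrite ball_itv /= in_itv /=; lra.
Qed.

Lemma good_beyond_approx (theta : R) : 0 < theta ->
  (forall N, good_beyond N theta) -> approx_exponents Phi theta.
Proof.
move=> t0 good; split=> //; apply: unbounded_infinite_set => N.
case: (good N) => [/= /(lt_trans t0)|[n /=]]; first by rewrite ltxx.
rewrite geq_max => /andP[Nn n0] Vt.
by exists n => //; split=> //; exact: near_above_dist_int.
Qed.

(** Both claims of the theorem are instances: [C] empty gives density, and [C]
    equal to the set of exponents itself gives uncountability. *)
Lemma approx_exponents_meet (O C : set R) : open O ->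
  (exists2 x, O x & 0 < x) -> countable C ->
  exists theta, [/\ O theta, approx_exponents Phi theta & ~ C theta].
Proof.
move=> oO [x Ox x0] /pcard_surjP[e eC].
have : dense (\bigcap_N (good_beyond N `&` ~` [set e N])).
  apply: (@Baire R R) => N; split.
    apply: openI; first exact: open_good_beyond.
    rewrite openC; apply: accessible_closed_set1.
    by apply: hausdorff_accessible; exact: Rhausdorff.
  apply: denseI; [exact: open_good_beyond | exact: dense_good_beyond |].
  exact: dense_set1C.
move=> /(_ (O `&` [set t | 0 < t])) [||t [[Ot t0] good]].
- by exists x.
- by apply: openI => //; exact: open_gt.
exists t; split=> //.
  by apply: good_beyond_approx => // N; case: (good N I).
by move=> /eC[N _ etN]; case: (good N I) => _; apply.
Qed.

End NearAbove.

Theorem theorem1p6 (R : realType) (Phi : nat -> R)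
    (Phi_gt0 : forall n : nat, (0 < n)%N -> 0 < Phi n) :
  ~ countable (approx_exponents Phi) /\
  [set x : R | 0 < x] `<=` closure (approx_exponents Phi).
Proof.
split.
  move=> cE; have [||t [_ Et]] :=
    @approx_exponents_meet _ _ Phi_gt0 setT _ _ _ cE.
  - exact: openT.
  - by exists 1.
  by apply.
move=> x /= x0 B; rewrite nbhsE; case=> O [oO Ox] OB.
have [|t [Ot Et _]] :=
  @approx_exponents_meet _ _ Phi_gt0 O set0 oO _ (countable0 _).
  by exists x.
by exists t; split=> //; exact: OB.
Qed.
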